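(* Maximal SSG restricted to DAGs admits a polynomial-time approximation scheme: for every fixed integer $k\ge 1$ there is a polynomial-time algorithm that, given a DAG $G=(V,A)$, nonnegative weights $w$ and a bound $B>0$, outputs a feasible solution $S$ of Maximal SSG with $w(S)\le \frac{k+1}{k}\,\mathrm{OPT}$, where $\mathrm{OPT}$ is the optimal value of Maximal SSG on this instance.
   Context: A DAG is a digraph with no directed circuit. $w(S)=\sum_{v\in S}w(v)$. A set $S\subseteq V$ satisfies the digraph constraints if for every $x\in S$ and every arc $(x,y)\in A$, $y\in S$. Maximal SSG: given a digraph $G=(V,A)$, nonnegative weights $w$ and a bound $B>0$, a feasible solution is a set $S\subseteq V$ satisfying the digraph constraints and $w(S)\le B$ such that no $S'\supsetneq S$ satisfies both the digraph constraints and $w(S')\le B$; the goal is to minimize $w(S)$. *)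

(* Defs.v *)
From Stdlib Require Import BinNums.
From mathcomp Require Import all_boot all_order all_algebra.

Set Implicit Arguments.
Unset Strict Implicit.
Unset Printing Implicit Defensive.

Import Order.TTheory GRing.Theory Num.Theory.

(** * Maximal SSG *)

(* A digraph on the finite vertex set V is its arc relation. A directed circuit
   is a nonempty closed walk without repeated vertices (loops included). *)
Definition dag (V : finType) (A : rel V) : Prop :=
  forall c : seq V, c != [::] -> ~ ucycle A c.

Section MaximalSSG.
Local Open Scope ring_scope.
Variables (V : finType) (A : rel V) (w : V -> rat) (B : rat).
Implicit Types S T : {set V}.

Definition weight S : rat := \sum_(v in S) w v.

Definition digraph_constraints S : Prop :=
  forall x y, x \in S -> A x y -> y \in S.

Definition ssg_set S : Prop := digraph_constraints S /\ weight S <= B.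

Definition feasible S : Prop :=
  ssg_set S /\ forall T, S \proper T -> ~ ssg_set T.

Definition optimal_value (opt : rat) : Prop :=
  (exists2 S, feasible S & weight S = opt) /\
  (forall S, feasible S -> opt <= weight S).

End MaximalSSG.

(** * Model of computation *)

(* The WHILE language over binary trees, with its unit-cost timed semantics
   (N. D. Jones, "Computability and Complexity from a Programming Perspective",
   MIT Press 1997). Every elementary operation manipulates pointers only, so
   that it takes constant time on a machine with shared tree cells; functions
   with polynomially bounded output that are computable in polynomial time in
   this model are exactly those computable in polynomial time by Turing
   machines. *)

Inductive tree : Type := Nil | Cons of tree & tree.

Fixpoint tree_size (d : tree) : nat :=
  if d is Cons a b then (tree_size a + tree_size b).+1 else 1.

Definition tree_hd (d : tree) : tree := if d is Cons a _ then a else Nil.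
Definition tree_tl (d : tree) : tree := if d is Cons _ b then b else Nil.

Inductive expr : Type :=
  | EVar of nat
  | ENil
  | ECons of expr & expr
  | EHd of expr
  | ETl of expr.

(* Nil is false, every other tree is true. *)
Inductive cmd : Type :=
  | CAssign of nat & expr
  | CSeq of cmd & cmd
  | CIf of expr & cmd & cmd
  | CWhile of expr & cmd.

Definition store := nat -> tree.

Definition update (s : store) (x : nat) (d : tree) : store :=
  fun y => if y == x then d else s y.

Fixpoint eval (s : store) (e : expr) : tree :=
  match e with
  | EVar x => s x
  | ENil => Nil
  | ECons e1 e2 => Cons (eval s e1) (eval s e2)
  | EHd e1 => tree_hd (eval s e1)
  | ETl e1 => tree_tl (eval s e1)
  end.

Fixpoint eval_time (e : expr) : nat :=
  match e with
  | EVar _ | ENil => 1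
  | ECons e1 e2 => (eval_time e1 + eval_time e2).+1
  | EHd e1 | ETl e1 => (eval_time e1).+1
  end.

(* [exec c s t s']: started in the store [s], the command [c] halts after
   exactly [t] time units in the store [s']. *)
Inductive exec : cmd -> store -> nat -> store -> Prop :=
  | ExecAssign x e s :
      exec (CAssign x e) s (eval_time e).+1 (update s x (eval s e))
  | ExecSeq c1 c2 s s1 s2 t1 t2 :
      exec c1 s t1 s1 -> exec c2 s1 t2 s2 -> exec (CSeq c1 c2) s (t1 + t2) s2
  | ExecIfTrue e c1 c2 s t s1 :
      eval s e <> Nil -> exec c1 s t s1 ->
      exec (CIf e c1 c2) s (eval_time e + t).+1 s1
  | ExecIfFalse e c1 c2 s t s1 :
      eval s e = Nil -> exec c2 s t s1 ->
      exec (CIf e c1 c2) s (eval_time e + t).+1 s1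
  | ExecWhileTrue e c s s1 s2 t1 t2 :
      eval s e <> Nil -> exec c s t1 s1 -> exec (CWhile e c) s1 t2 s2 ->
      exec (CWhile e c) s (eval_time e + t1 + t2).+1 s2
  | ExecWhileFalse e c s :
      eval s e = Nil -> exec (CWhile e c) s (eval_time e).+1 s.

(* Input and output are held in variable 0; all other variables start at Nil. *)
Definition init (input : tree) : store := update (fun=> Nil) 0 input.

Definition runs (p : cmd) (input : tree) (t : nat) (output : tree) : Prop :=
  exists2 s, exec p (init input) t s & s 0 = output.

Lemma exec_det c s t s' t' s'' :
  exec c s t s' -> exec c s t' s'' -> t = t' /\ s' = s''.
Proof.
move=> h; elim: h t' s'' => {c s t s'}; intros;
  match goal with H : exec _ _ ?t _ |- _ = ?t /\ _ => inversion H; subst end => //;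
  repeat match goal with
  | IH : (forall t' s'', exec ?c ?s t' s'' -> _), H : exec ?c ?s _ _ |- _ =>
      case: (IH _ _ H) => ? ?; subst; clear IH
  end; by [].
Qed.

(** * Encoding of instances and solutions *)

Definition enc_bool (b : bool) : tree := if b then Cons Nil Nil else Nil.

Definition enc_seq (T : Type) (enc : T -> tree) (s : seq T) : tree :=
  foldr (fun x d => Cons (enc x) d) Nil s.

(* Binary digits, least significant first, without leading zeros. *)
Fixpoint pos_bits (p : positive) : seq bool :=
  match p with
  | xH => [:: true]
  | xO q => false :: pos_bits q
  | xI q => true :: pos_bits q
  end.

Definition nat_bits (n : nat) : seq bool :=
  if bin_of_nat n is Npos p then pos_bits p else [::].

Definition enc_nat (n : nat) : tree := enc_seq enc_bool (nat_bits n).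

(* For nonnegative rationals, as a reduced fraction; no sign is recorded. *)
Definition enc_rat (q : rat) : tree :=
  Cons (enc_nat `|numq q|%N) (enc_nat `|denq q|%N).

(* The bound, the list of weights and the adjacency matrix; vertices are listed
   in the order [enum V]. *)
Definition enc_instance (V : finType) (A : rel V) (w : V -> rat) (B : rat) :
    tree :=
  Cons (enc_rat B)
    (Cons (enc_seq (fun v => enc_rat (w v)) (enum V))
          (enc_seq (fun x => enc_seq (fun y => enc_bool (A x y)) (enum V))
                   (enum V))).

(* The characteristic vector of S. *)
Definition enc_set (V : finType) (S : {set V}) : tree :=
  enc_seq (fun v => enc_bool (v \in S)) (enum V).

(* Main.v *)
From Stdlib Require Import BinNums.
From mathcomp Require Import all_boot all_order all_algebra zify lra.
Require Import Defs.

Set Implicit Arguments.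
Unset Strict Implicit.
Unset Printing Implicit Defensive.

Import Order.TTheory GRing.Theory Num.Theory.

(* In a DAG, a closed set is maximal as soon as no single vertex can be added to
   it. Let [S] be an optimal solution. If [w(S) >= kB/(k+1)], every feasible
   solution is within the factor [(k+1)/k]. Otherwise every vertex that can be
   added to [S] without violating the digraph constraints is heavy, i.e. weighs
   more than [B/(k+1)], and [S] contains at most [k] heavy vertices. Adding
   greedily light vertices and heavy vertices of [S], starting from the empty
   set, then rebuilds exactly [S]: a set where this stops strictly inside [S]
   would leave out a sink of the difference. So it suffices to try all sets [H]
   of at most [k] vertices, to run the greedy procedure on the light vertices
   and [H], to complete the result greedily to a maximal set, and to keep the
   lightest outcome.

   The running time is handled by a calculus of polynomial-time computability
   for families of trees: closure under composition, pairing, tests and loops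
   over lists whose state stays polynomially bounded. *)

(** * Polynomial bounds *)

Definition poly_bounded (X : Type) (N T : X -> nat) : Prop :=
  exists c d, forall x, T x <= c * (N x).+1 ^ d.

Section PolyBounded.
Variables (X : Type) (N : X -> nat).
Implicit Types T : X -> nat.

Lemma poly_boundedW T T' :
  (forall x, T' x <= T x) -> poly_bounded N T -> poly_bounded N T'.
Proof.
by move=> leT [c [d leN]]; exists c, d => x; apply: leq_trans (leT x) (leN x).
Qed.

Lemma poly_bounded_id : poly_bounded N N.
Proof. by exists 1, 1 => x; rewrite mul1n expn1. Qed.

Lemma poly_bounded_const n : poly_bounded N (fun=> n).
Proof. by exists n, 0 => x; rewrite expn0 muln1. Qed.

Lemma poly_boundedD T1 T2 :
  poly_bounded N T1 -> poly_bounded N T2 ->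
  poly_bounded N (fun x => T1 x + T2 x).
Proof.
move=> [c1 [d1 le1]] [c2 [d2 le2]]; exists (c1 + c2), (d1 + d2) => x.
rewrite mulnDl leq_add //.
  by apply: leq_trans (le1 x) _; rewrite leq_mul2l leq_pexp2l ?orbT ?leq_addr.
by apply: leq_trans (le2 x) _; rewrite leq_mul2l leq_pexp2l ?orbT ?leq_addl.
Qed.

Lemma poly_boundedM T1 T2 :
  poly_bounded N T1 -> poly_bounded N T2 ->
  poly_bounded N (fun x => T1 x * T2 x).
Proof.
move=> [c1 [d1 le1]] [c2 [d2 le2]]; exists (c1 * c2), (d1 + d2) => x.
by rewrite expnD mulnACA leq_mul.
Qed.

Lemma poly_boundedX T n :
  poly_bounded N T -> poly_bounded N (fun x => T x ^ n).
Proof.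
move=> bT; elim: n => [|n IHn]; first exact: poly_bounded_const.
by apply: poly_boundedW (poly_boundedM bT IHn) => x; rewrite expnS.
Qed.

End PolyBounded.

Lemma poly_bounded_reindex X Y (h : Y -> X) (N T : X -> nat) :
  poly_bounded N T -> poly_bounded (N \o h) (T \o h).
Proof. by move=> [c [d leT]]; exists c, d => y; apply: leT. Qed.

Lemma poly_bounded_uniform X Z (M b : X -> nat) (N T : Z -> nat) :
  poly_bounded M b -> poly_bounded N T ->
  exists2 K, poly_bounded M K & forall x z, N z <= b x -> T z <= K x.
Proof.
move=> bb [c [d leT]]; exists (fun x => c * (b x + 1) ^ d).
  apply: poly_boundedM; first exact: poly_bounded_const.
  apply: poly_boundedX; apply: poly_boundedD => //; exact: poly_bounded_const.
move=> x z le_b; apply: leq_trans (leT z) _; rewrite addn1 leq_mul2l.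
by case: d {leT} => [|d]; rewrite ?expn0 ?leq_exp2r ?ltnS ?le_b // orbT.
Qed.

Lemma poly_bounded_trans X (N M T : X -> nat) :
  poly_bounded N M -> poly_bounded M T -> poly_bounded N T.
Proof.
move=> bM bT; have [K bK leK] := poly_bounded_uniform bM bT.
by apply: poly_boundedW bK => x; apply: leK.
Qed.

(** * Polynomial-time families of trees *)

Lemma tree_size_gt0 d : 0 < tree_size d.
Proof. by case: d. Qed.

Lemma update_eq s x d : update s x d x = d.
Proof. by rewrite /update eqxx. Qed.

Lemma update_neq s x d y : y != x -> update s x d y = s y.
Proof. by rewrite /update => /negbTE->. Qed.

(* The variables below [m] are scratch space, with arbitrary initial values. *)
Definition computes (X : Type) (f g : X -> tree) (p : cmd) (m : nat)
    (T : X -> nat) : Prop :=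
  forall x s, s 0 = f x ->
  exists t s', [/\ exec p s t s', s' 0 = g x,
    forall y, m <= y -> s' y = s y & t <= T x].

(* The size of [g] is bounded separately because sharing lets a WHILE program
   build exponentially large trees in polynomial time. *)
Definition polytime (X : Type) (f g : X -> tree) : Prop :=
  exists p m T, [/\ poly_bounded (tree_size \o f) T,
    poly_bounded (tree_size \o f) (tree_size \o g) & computes f g p m T].

Lemma polytime_size X (f g : X -> tree) :
  polytime f g -> poly_bounded (tree_size \o f) (tree_size \o g).
Proof. by case=> p [m [T []]]. Qed.

Lemma polytime_runs X (f g : X -> tree) : polytime f g ->
  exists p c d, forall x, exists t,
    runs p (f x) t (g x) /\ t <= c * tree_size (f x) ^ d + c.
Proof.
move=> [p [m [T [[c [d leT]] _ run]]]].
exists p, (c * 2 ^ d), d => x.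
have [//|t [s [es s0 _ tT]]] := run x (init (f x)).
exists t; split; first by exists s.
apply: leq_trans tT (leq_trans (leT x) (leq_trans _ (leq_addr _ _))).
rewrite -mulnA -expnMn leq_mul2l; apply/orP; right.
have := tree_size_gt0 (f x).
by case: d {leT} => // d size_gt0; rewrite leq_exp2r //=; lia.
Qed.

Lemma polytime_ext X (f g g' : X -> tree) :
  g =1 g' -> polytime f g -> polytime f g'.
Proof.
move=> eq_g [p [m [T [bT bg run]]]]; exists p, m, T; split=> //.
  by apply: poly_boundedW bg => x; rewrite /= eq_g.
by move=> x s; rewrite -eq_g; apply: run.
Qed.

Lemma polytime_reindex X Y (h : Y -> X) (f g : X -> tree) :
  polytime f g -> polytime (fun y => f (h y)) (fun y => g (h y)).
Proof.
move=> [p [m [T [bT bg run]]]]; exists p, m, (T \o h); split.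
- exact: (poly_bounded_reindex h bT).
- exact: (poly_bounded_reindex h bg).
- by move=> y s; apply: run.
Qed.

Lemma polytime_comp X (f g h : X -> tree) :
  polytime f g -> polytime g h -> polytime f h.
Proof.
move=> [p [m [T [bT bg run]]]] [p' [m' [T' [bT' bh run']]]].
exists (CSeq p p'), (maxn m m'), (fun x => T x + T' x); split.
- exact: poly_boundedD bT (poly_bounded_trans bg bT').
- exact: poly_bounded_trans bg bh.
move=> x s /run [t [s1 [e1 /run' [t' [s2 [e2 s2x keep2 le2]]] keep1 le1]]].
exists (t + t'), s2; split=> //; first exact: ExecSeq e1 e2.
- by move=> y; rewrite geq_max => /andP [my m'y]; rewrite keep2 ?keep1.
- exact: leq_add.
Qed.

Lemma polytime_lift X Y (h : Y -> X) (f g : X -> tree) (f' : Y -> tree) :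
  polytime f' (fun y => f (h y)) -> polytime f g ->
  polytime f' (fun y => g (h y)).
Proof. by move=> Hf Hg; apply: polytime_comp Hf (polytime_reindex h Hg). Qed.

Lemma tree_size_eval d e :
  tree_size (eval (fun=> d) e) <= eval_time e * tree_size d.
Proof.
have size_gt0 := tree_size_gt0 d.
elim: e => [x||e1 IH1 e2 IH2|e|e] /=; try lia.
- by case: (eval _ e) => /= *; lia.
- by case: (eval _ e) => /= *; lia.
Qed.

Lemma polytime_expr X (f g : X -> tree) e :
  (forall x s, s 0 = f x -> eval s e = g x) -> polytime f g.
Proof.
move=> eval_e; exists (CAssign 0 e), 1, (fun=> (eval_time e).+1); split.
- exact: poly_bounded_const.
- apply: poly_boundedW (poly_boundedM (poly_bounded_const _ (eval_time e))
    (poly_bounded_id _)) => x /=.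
  by rewrite -(eval_e x (fun=> f x)) // tree_size_eval.
move=> x s sx; exists (eval_time e).+1, (update s 0 (g x)).
split=> //; last by case.
by rewrite -(eval_e x s sx); apply: ExecAssign.
Qed.

Lemma polytime_id X (f : X -> tree) : polytime f f.
Proof. exact: (polytime_expr (e := EVar 0)). Qed.

Lemma polytime_nil X (f : X -> tree) : polytime f (fun=> Nil).
Proof. exact: (polytime_expr (e := ENil)). Qed.

Lemma polytime_hd X (f g : X -> tree) :
  polytime f g -> polytime f (fun x => tree_hd (g x)).
Proof.
move=> Hg; apply: polytime_comp Hg _.
by apply: (polytime_expr (e := EHd (EVar 0))) => x s /= ->.
Qed.

Lemma polytime_tl X (f g : X -> tree) :
  polytime f g -> polytime f (fun x => tree_tl (g x)).
Proof.
move=> Hg; apply: polytime_comp Hg _.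
by apply: (polytime_expr (e := ETl (EVar 0))) => x s /= ->.
Qed.

Lemma polytime_fst X (f g : X -> tree) :
  polytime (fun x => Cons (f x) (g x)) f.
Proof. exact: (polytime_hd (polytime_id _)). Qed.

Lemma polytime_snd X (f g : X -> tree) :
  polytime (fun x => Cons (f x) (g x)) g.
Proof. exact: (polytime_tl (polytime_id _)). Qed.

Lemma polytime_first X (f g r : X -> tree) : polytime f g ->
  polytime (fun x => Cons (f x) (r x)) (fun x => Cons (g x) (r x)).
Proof.
move=> [p [m [T [bT bg run]]]]; set fr := (fun x => Cons (f x) (r x)).
have bfr : poly_bounded (tree_size \o fr) (tree_size \o fr).
  exact: poly_bounded_id.
have bf : poly_bounded (tree_size \o fr) (tree_size \o f).
  by apply: poly_boundedW bfr => x /=; lia.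
exists (CSeq (CAssign m.+1 (ETl (EVar 0))) (CSeq (CAssign 0 (EHd (EVar 0)))
  (CSeq p (CAssign 0 (ECons (EVar 0) (EVar m.+1)))))).
exists m.+2, (fun x => T x + 10); split.
- exact: poly_boundedD (poly_bounded_trans bf bT) (poly_bounded_const _ _).
- apply: poly_boundedW (poly_boundedD (poly_bounded_trans bf bg) bfr) => x /=.
  by lia.
move=> x s sx.
pose s1 := update s m.+1 (tree_tl (s 0)).
pose s2 := update s1 0 (tree_hd (s1 0)).
have [|t [s3 [e3 s3x keep3 le3]]] := run x s2.
  by rewrite /s2 update_eq /s1 update_neq // sx.
eexists _, _; split.
- apply: ExecSeq; first exact: ExecAssign.
  apply: ExecSeq; first exact: ExecAssign.
  apply: ExecSeq; [exact: e3 | exact: ExecAssign].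
- rewrite update_eq /= s3x keep3; last lia.
  by rewrite /s2 update_neq // /s1 update_eq sx.
- move=> y m2y; rewrite update_neq; last lia.
  rewrite keep3; last lia.
  by rewrite /s2 update_neq ?/s1 ?update_neq //; lia.
- by rewrite /=; lia.
Qed.

Lemma polytime_swap X (f g : X -> tree) :
  polytime (fun x => Cons (f x) (g x)) (fun x => Cons (g x) (f x)).
Proof.
apply: (polytime_expr (e := ECons (ETl (EVar 0)) (EHd (EVar 0)))).
by move=> x s /= ->.
Qed.

Lemma polytime_cons X (f g h : X -> tree) :
  polytime f g -> polytime f h -> polytime f (fun x => Cons (g x) (h x)).
Proof.
move=> Hg Hh; have Hdup : polytime f (fun x => Cons (f x) (f x)).
  by apply: (polytime_expr (e := ECons (EVar 0) (EVar 0))) => x s /= ->.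
apply: polytime_comp Hdup (polytime_comp (polytime_first f Hg) _).
apply: polytime_comp (polytime_swap _ _) _.
exact: polytime_comp (polytime_first g Hh) (polytime_swap _ _).
Qed.

Lemma polytime_const X (f : X -> tree) (d : tree) : polytime f (fun=> d).
Proof.
by elim: d => [|a Ha b Hb]; [apply: polytime_nil | apply: polytime_cons].
Qed.

Lemma polytime_ifnil X (f c g h : X -> tree) :
  polytime f c -> polytime f g -> polytime f h ->
  polytime f (fun x => if c x is Nil then h x else g x).
Proof.
move=> Hc Hg Hh; apply: polytime_comp (polytime_cons Hc (polytime_id f)) _.
have [p [m [T [bT bg run]]]] := polytime_comp (polytime_snd c f) Hg.
have [p' [m' [T' [bT' bh run']]]] := polytime_comp (polytime_snd c f) Hh.
exists (CIf (EHd (EVar 0)) p p'), (maxn m m'), (fun x => T x + T' x + 3).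
split.
- by apply: poly_boundedD; [apply: poly_boundedD | apply: poly_bounded_const].
- by apply: poly_boundedW (poly_boundedD bg bh) => x /=; case: (c x) => *; lia.
move=> x s sx; have sc : eval s (EHd (EVar 0)) = c x by rewrite /= sx.
case Ec: (c x) sc => [|a b] sc.
  have [t [s1 [e1 s1x keep le1]]] := run' x s sx.
  exists (2 + t).+1, s1; split=> //; first exact: ExecIfFalse.
    by move=> y; rewrite geq_max => /andP [_ /keep].
  by lia.
have [t [s1 [e1 s1x keep le1]]] := run x s sx.
exists (2 + t).+1, s1; split=> //.
- by apply: ExecIfTrue => //; rewrite sc.
- by move=> y; rewrite geq_max => /andP [/keep].
- by lia.
Qed.

Lemma polytime_if X (f : X -> tree) (S : X -> Type) (e : forall x, S x -> tree)
    (b : X -> bool) (s t : forall x, S x) :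
  polytime f (fun x => enc_bool (b x)) ->
  polytime f (fun x => e _ (s x)) -> polytime f (fun x => e _ (t x)) ->
  polytime f (fun x => e _ (if b x then s x else t x)).
Proof.
move=> Hb Hs Ht; apply: polytime_ext (polytime_ifnil Hb Hs Ht) => x.
by case: (b x).
Qed.

Lemma tree_size_enc_bool b : tree_size (enc_bool b) <= 3.
Proof. by case: b. Qed.

Lemma polytime_bool2 (op : bool -> bool -> bool) X (f : X -> tree)
    (a b : X -> bool) :
  polytime f (fun x => enc_bool (a x)) ->
  polytime f (fun x => enc_bool (b x)) ->
  polytime f (fun x => enc_bool (op (a x) (b x))).
Proof.
move=> Ha Hb; have Hop c : polytime f (fun x => enc_bool (op c (b x))).
  apply: polytime_ext (polytime_if (e := fun=> enc_bool) Hb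
    (polytime_const f (enc_bool (op c true)))
    (polytime_const f (enc_bool (op c false)))) => x.
  by case: (b x).
apply: polytime_ext (polytime_if (e := fun=> enc_bool) Ha
  (Hop true) (Hop false)) => x.
by case: (a x).
Qed.

(* [st x i] is the content of variable 0 after [i] rounds; the test of the loop
   is the head of that tree, and [F], [G] describe one round. *)
Lemma polytime_while X Z (F G : Z -> tree) (st : X -> nat -> tree)
    (n b : X -> nat) :
  polytime F G ->
  (forall x i, i < n x ->
    tree_hd (st x i) <> Nil /\ exists2 z, F z = st x i & G z = st x i.+1) ->
  (forall x, tree_hd (st x (n x)) = Nil) ->
  (forall x i, i <= n x -> tree_size (st x i) <= b x) ->
  poly_bounded (tree_size \o st^~ 0) n ->
  poly_bounded (tree_size \o st^~ 0) b ->
  polytime (st^~ 0) (fun x => st x (n x)).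
Proof.
move=> [p [m [T [bT _ run]]]] round stop size_st bn bb.
have [K bK leK] := poly_bounded_uniform bb bT.
exists (CWhile (EHd (EVar 0)) p), (maxn m 1), (fun x => n x * (K x + 3) + 3).
split.
- apply: poly_boundedD; last exact: poly_bounded_const.
  by apply: poly_boundedM bn (poly_boundedD bK (poly_bounded_const _ _)).
- by apply: poly_boundedW bb => x; apply: size_st.
move=> x; have loop k i s : i + k = n x -> s 0 = st x i ->
    exists t s', [/\ exec (CWhile (EHd (EVar 0)) p) s t s', s' 0 = st x (n x),
      forall y, maxn m 1 <= y -> s' y = s y & t <= k * (K x + 3) + 3].
  elim: k i s => [|k IHk] i s ik si.
    rewrite addn0 in ik; exists 3, s; split; rewrite ?leq_addl //.
      by apply: ExecWhileFalse; rewrite /= si ik.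
    by rewrite si ik.
  have lt_in : i < n x by lia.
  have [hd_st [z Fz Gz]] := round x i lt_in.
  have [|t1 [s1 [e1 s1z keep1 le1]]] := run z s; first by rewrite si.
  have [||t2 [s2 [e2 s2x keep2 le2]]] := IHk i.+1 s1; first by lia.
    by rewrite s1z.
  have leTz : T z <= K x by apply: leK; rewrite /= Fz size_st // ltnW.
  exists (2 + t1 + t2).+1, s2; split=> //.
  - by apply: ExecWhileTrue e1 e2; rewrite /= si.
  - by move=> y my; rewrite keep2 ?keep1 //; lia.
  - by rewrite mulSn; lia.
by move=> s; apply: (loop (n x) 0).
Qed.

(* The context [g] may be anything from which [f] and the argument of [F] are
   computable; quantifying over it spares the user all projections. *)
Definition polytime1 (X : Type) (f : X -> tree) (S R : X -> Type)
    (eS : forall x, S x -> tree) (eR : forall x, R x -> tree)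
    (F : forall x, S x -> R x) : Prop :=
  forall Y (h : Y -> X) (g : Y -> tree) (s : forall y, S (h y)),
    polytime g (fun y => f (h y)) -> polytime g (fun y => eS _ (s y)) ->
    polytime g (fun y => eR _ (F _ (s y))).

Definition polytime2 (X : Type) (f : X -> tree) (S T R : X -> Type)
    (eS : forall x, S x -> tree) (eT : forall x, T x -> tree)
    (eR : forall x, R x -> tree) (F : forall x, S x -> T x -> R x) : Prop :=
  forall Y (h : Y -> X) (g : Y -> tree) (s : forall y, S (h y))
      (t : forall y, T (h y)),
    polytime g (fun y => f (h y)) -> polytime g (fun y => eS _ (s y)) ->
    polytime g (fun y => eT _ (t y)) ->
    polytime g (fun y => eR _ (F _ (s y) (t y))).

(** * Loops over lists *)

Section EncSeq.
Variables (T : Type) (e : T -> tree).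
Implicit Types l : seq T.

Lemma size_le_enc_seq l : size l <= tree_size (enc_seq e l).
Proof. by elim: l => //= t l IH; lia. Qed.

Lemma tree_size_enc_seq_cat l1 l2 :
  (tree_size (enc_seq e (l1 ++ l2))).+1 =
  tree_size (enc_seq e l1) + tree_size (enc_seq e l2).
Proof. by elim: l1 => [|t l1 IH] /=; lia. Qed.

Lemma leq_enc_seq_prefix l1 l2 :
  tree_size (enc_seq e l1) <= tree_size (enc_seq e (l1 ++ l2)).
Proof.
have := tree_size_gt0 (enc_seq e l2).
by have := tree_size_enc_seq_cat l1 l2; lia.
Qed.

Lemma leq_enc_seq_suffix l1 l2 :
  tree_size (enc_seq e l2) <= tree_size (enc_seq e (l1 ++ l2)).
Proof.
have := tree_size_gt0 (enc_seq e l1).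
by have := tree_size_enc_seq_cat l1 l2; lia.
Qed.

Lemma tree_size_enc_seq_le n l :
  (forall t, tree_size (e t) <= n) ->
  tree_size (enc_seq e l) <= n.+1 * size l + 1.
Proof.
by move=> le_n; elim: l => /= [|t l IH]; [lia | have := le_n t; lia].
Qed.

Lemma enc_seq_map (S : Type) (g : S -> T) (l : seq S) :
  enc_seq e (map g l) = enc_seq (e \o g) l.
Proof. by elim: l => //= s l ->. Qed.

End EncSeq.

Lemma eq_enc_seq (T : Type) (e e' : T -> tree) :
  e =1 e' -> enc_seq e =1 enc_seq e'.
Proof. by move=> ee' l; elim: l => //= t l ->; rewrite ee'. Qed.

Section Folds.
Variables (X : Type) (f : X -> tree) (T S : X -> Type).
Variables (eT : forall x, T x -> tree) (eS : forall x, S x -> tree).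

(* The content of variable 0 between two rounds of a loop in the state [s] that
   still has to read [r]. *)
Definition fold_state x (s : S x) (r : seq (T x)) : tree :=
  Cons (enc_seq (@eT x) r) (Cons (f x) (eS s)).

Lemma polytime_fold_round (step : forall x, S x -> T x -> S x) :
  polytime2 f eS eT eS step ->
  polytime (fun z : {x : X & S x * T x * seq (T x)}%type =>
      fold_state (tagged z).1.1 ((tagged z).1.2 :: (tagged z).2))
    (fun z => fold_state (step _ (tagged z).1.1 (tagged z).1.2) (tagged z).2).
Proof.
move=> Hstep; set F := (fun z => fold_state _ (_ :: _)).
have HF := polytime_id F.
have [Hlist Hrest] := (polytime_hd HF, polytime_tl HF).
apply: polytime_cons (polytime_tl Hlist) (polytime_cons (polytime_hd Hrest) _).
apply: (Hstep {x : X & S x * T x * seq (T x)}%type (@tag _ _)).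
- exact: polytime_hd Hrest.
- exact: polytime_tl Hrest.
- exact: polytime_hd Hlist.
Qed.

Variables (l : forall x, seq (T x)) (s0 : forall x, S x).
Hypotheses (Hl : polytime f (fun x => enc_seq (@eT x) (l x)))
  (Hs0 : polytime f (fun x => eS (s0 x))).

Lemma polytime_foldl (step : forall x, S x -> T x -> S x) (b : X -> nat) :
  polytime2 f eS eT eS step -> poly_bounded (tree_size \o f) b ->
  (forall x pre suf, l x = pre ++ suf ->
    tree_size (eS (foldl (@step x) (s0 x) pre)) <= b x) ->
  polytime f (fun x => eS (foldl (@step x) (s0 x) (l x))).
Proof.
move=> /polytime_fold_round Hround bb size_st.
pose L x := tree_size (enc_seq (@eT x) (l x)).
pose st x i :=
  fold_state (foldl (@step x) (s0 x) (take i (l x))) (drop i (l x)).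
have Hst0 : polytime f (st^~ 0).
  apply: polytime_ext (polytime_cons Hl (polytime_cons (polytime_id f) Hs0)).
  by move=> x; rewrite /st drop0 take0.
suff Hend : polytime (st^~ 0) (fun x => st x (size (l x))).
  apply: polytime_ext (polytime_tl (polytime_tl (polytime_comp Hst0 Hend))).
  by move=> x; rewrite /= take_size.
have bf : poly_bounded (tree_size \o st^~ 0) (tree_size \o f).
  by apply: poly_boundedW (poly_bounded_id _) => x /=; lia.
have bL : poly_bounded (tree_size \o st^~ 0) L.
  exact: poly_bounded_trans bf (polytime_size Hl).
apply: (polytime_while (st := st)
  (b := fun x => L x + tree_size (f x) + b x + 2) Hround) => [x i||x i _||].
- rewrite /st; case: (l x) => [|t0 l'] // lt_i.
  rewrite (drop_nth t0 lt_i) (take_nth t0 lt_i) foldl_rcons; split=> //.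
  by exists (existT _ x (foldl (@step x) (s0 x) (take i (t0 :: l')),
    nth t0 (t0 :: l') i, drop i.+1 (t0 :: l'))).
- by move=> x; rewrite /st /= drop_size.
- have := size_st x (take i (l x)) (drop i (l x)) (esym (cat_take_drop _ _)).
  have := leq_enc_seq_suffix (@eT x) (take i (l x)) (drop i (l x)).
  by rewrite cat_take_drop /L /=; lia.
- by apply: poly_boundedW bL => x; apply: size_le_enc_seq.
- apply: poly_boundedD (poly_bounded_const _ _).
  exact: poly_boundedD (poly_boundedD bL bf) (poly_bounded_trans bf bb).
Qed.

Lemma polytime_foldl_incr (step : forall x, S x -> T x -> S x)
    (D : {x : X & T x} -> nat) :
  polytime2 f eS eT eS step ->
  poly_bounded (fun z => tree_size (Cons (f (tag z)) (eT (tagged z)))) D ->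
  (forall x s t, tree_size (eS (step x s t)) <=
     tree_size (eS s) + D (Tagged T t)) ->
  polytime f (fun x => eS (foldl (@step x) (s0 x) (l x))).
Proof.
move=> Hstep bD incr; pose L x := tree_size (enc_seq (@eT x) (l x)).
have bL : poly_bounded (tree_size \o f) L by apply: polytime_size Hl.
have bfL : poly_bounded (tree_size \o f) (fun x => tree_size (f x) + L x).
  by apply: poly_boundedD bL; apply: poly_bounded_id.
have [K bK leK] := poly_bounded_uniform bfL bD.
apply: (polytime_foldl (b := fun x => tree_size (eS (s0 x)) + L x * K x) Hstep).
  exact: poly_boundedD (polytime_size Hs0) (poly_boundedM bL bK).
move=> x pre suf lx; suff bound s : tree_size (eS (foldl (@step x) s pre)) <=
    tree_size (eS s) + size pre * K x.
  apply: leq_trans (bound _) _; rewrite leq_add2l leq_mul2r.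
  apply/orP; right; apply: leq_trans (size_le_enc_seq (@eT x) _) _.
  by rewrite /L lx leq_enc_seq_prefix.
have : tree_size (enc_seq (@eT x) pre) <= L x.
  by rewrite /L lx leq_enc_seq_prefix.
elim: pre s {lx} => [|t pre IH] s /= le_L; first exact: leq_addr.
have le_pre : tree_size (enc_seq (@eT x) pre) <= L x by lia.
have := IH (step x s t) le_pre; have := incr x s t.
by have := leK x (Tagged T t); rewrite /= mulSn; lia.
Qed.

Lemma polytime_iter (F : forall x, S x -> S x) (b : X -> nat) :
  polytime1 f eS eS F -> poly_bounded (tree_size \o f) b ->
  (forall x i, i <= size (l x) ->
    tree_size (eS (iter i (@F x) (s0 x))) <= b x) ->
  polytime f (fun x => eS (iter (size (l x)) (@F x) (s0 x))).
Proof.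
move=> HF bb size_iter.
have iterE x r : iter (size r) (@F x) (s0 x) =
    foldl (fun s (_ : T x) => F x s) (s0 x) r.
  by elim/last_ind: r => // r t IH; rewrite size_rcons foldl_rcons /= IH.
apply: polytime_ext (polytime_foldl (step := fun x s _ => F x s) _ bb _).
- by move=> x /=; rewrite iterE.
- by move=> Y h g s t Hf Hs _; apply: HF.
- by move=> x pre suf lx; rewrite -iterE size_iter // lx size_cat leq_addr.
Qed.

End Folds.

Lemma polytime_catrev X (f : X -> tree) (T : X -> Type)
    (e : forall x, T x -> tree) (l1 l2 : forall x, seq (T x)) :
  polytime f (fun x => enc_seq (@e x) (l1 x)) ->
  polytime f (fun x => enc_seq (@e x) (l2 x)) ->
  polytime f (fun x => enc_seq (@e x) (catrev (l1 x) (l2 x))).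
Proof.
move=> Hl1 Hl2; have catrevE x : foldl (fun s t => t :: s) (l2 x) (l1 x) =
    catrev (l1 x) (l2 x) by elim: (l1 x) (l2 x) => //= t r IH s.
apply: polytime_ext (polytime_foldl_incr (eS := fun x => enc_seq (@e x))
  (step := fun x s t => t :: s) (D := fun z => tree_size (e _ (tagged z)) + 1)
  Hl1 Hl2 _ _ _) => [x|Y h g s t _ Hs Ht||x s t].
- by rewrite catrevE.
- exact: polytime_cons Ht Hs.
- by apply: poly_boundedW (poly_bounded_id _) => z /=; lia.
- by rewrite /=; lia.
Qed.

Lemma polytime_rev X (f : X -> tree) (T : X -> Type)
    (e : forall x, T x -> tree) (l : forall x, seq (T x)) :
  polytime f (fun x => enc_seq (@e x) (l x)) ->
  polytime f (fun x => enc_seq (@e x) (rev (l x))).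
Proof.
by move=> Hl; apply: (polytime_catrev (l2 := fun=> [::]) Hl (polytime_nil f)).
Qed.

Lemma polytime_cat X (f : X -> tree) (T : X -> Type)
    (e : forall x, T x -> tree) (l1 l2 : forall x, seq (T x)) :
  polytime f (fun x => enc_seq (@e x) (l1 x)) ->
  polytime f (fun x => enc_seq (@e x) (l2 x)) ->
  polytime f (fun x => enc_seq (@e x) (l1 x ++ l2 x)).
Proof.
move=> /polytime_rev Hl1 Hl2.
apply: polytime_ext (polytime_catrev Hl1 Hl2) => x.
by rewrite catrevE revK.
Qed.

Section FoldRight.
Variables (X : Type) (f : X -> tree) (T S : X -> Type).
Variables (eT : forall x, T x -> tree) (eS : forall x, S x -> tree).
Variables (l : forall x, seq (T x)) (s0 : forall x, S x).
Hypotheses (Hl : polytime f (fun x => enc_seq (@eT x) (l x)))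
  (Hs0 : polytime f (fun x => eS (s0 x))).

Lemma polytime_foldr (step : forall x, T x -> S x -> S x) (b : X -> nat) :
  polytime2 f eT eS eS step -> poly_bounded (tree_size \o f) b ->
  (forall x pre suf, l x = pre ++ suf ->
    tree_size (eS (foldr (@step x) (s0 x) suf)) <= b x) ->
  polytime f (fun x => eS (foldr (@step x) (s0 x) (l x))).
Proof.
move=> Hstep bb size_st.
apply: polytime_ext (polytime_foldl (step := fun x s t => step x t s)
  (polytime_rev Hl) Hs0 _ bb _) => [x|Y h g s t Hf Hs Ht|x pre suf].
- by rewrite foldl_rev.
- exact: Hstep.
- move=> /(canRL revK); rewrite rev_cat -[pre in foldl _ _ pre]revK foldl_rev.
  exact: size_st.
Qed.

Lemma polytime_foldr_incr (step : forall x, T x -> S x -> S x)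
    (D : {x : X & T x} -> nat) :
  polytime2 f eT eS eS step ->
  poly_bounded (fun z => tree_size (Cons (f (tag z)) (eT (tagged z)))) D ->
  (forall x t s, tree_size (eS (step x t s)) <=
     tree_size (eS s) + D (Tagged T t)) ->
  polytime f (fun x => eS (foldr (@step x) (s0 x) (l x))).
Proof.
move=> Hstep bD incr.
apply: polytime_ext (polytime_foldl_incr (step := fun x s t => step x t s)
  (polytime_rev Hl) Hs0 _ bD _) => [x|Y h g s t Hf Hs Ht|x s t].
- by rewrite foldl_rev.
- exact: Hstep.
- exact: incr.
Qed.

End FoldRight.

Section Lists.
Variables (X : Type) (f : X -> tree) (T : X -> Type).
Variables (e : forall x, T x -> tree) (l : forall x, seq (T x)).
Hypothesis Hl : polytime f (fun x => enc_seq (@e x) (l x)).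

Lemma polytime_map (e' : forall x, T x -> tree) :
  polytime1 f e (fun _ => id) e' ->
  polytime f (fun x => enc_seq (@e' x) (l x)).
Proof.
move=> He'; pose C (z : {x : X & T x}) := Cons (f (tag z)) (e (tagged z)).
have bC : poly_bounded (tree_size \o C) (fun z => tree_size (e' _ (tagged z))).
  exact: polytime_size (He' _ _ C _ (polytime_fst _ _) (polytime_snd _ _)).
apply: (polytime_foldr_incr (eS := fun=> id)
  (step := fun x t d => Cons (e' x t) d)
  (D := fun z => tree_size (e' _ (tagged z)) + 1) Hl (polytime_nil f)).
- by move=> Y h g t s Hf Ht Hs; apply: polytime_cons Hs; apply: He'.
- by apply: poly_boundedD => //; apply: poly_bounded_const.
- by move=> x t d /=; lia.
Qed.

Lemma polytime_all (P : forall x, pred (T x)) :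
  polytime1 f e (fun _ => enc_bool) P ->
  polytime f (fun x => enc_bool (all (@P x) (l x))).
Proof.
move=> HP; apply: (polytime_foldr_incr (eS := fun=> enc_bool)
  (s0 := fun=> true) (step := fun x t b => P x t && b) (D := fun=> 3) Hl
  (polytime_const f _)).
- move=> Y h g t b Hf Ht Hb.
  exact: (polytime_bool2 andb (HP _ _ _ _ Hf Ht) Hb).
- exact: poly_bounded_const.
- by move=> x t b; apply: leq_trans (tree_size_enc_bool _) (leq_addl _ _).
Qed.

End Lists.

Definition enc_pair (S T : Type) (eS : S -> tree) (eT : T -> tree) (p : S * T) :
    tree :=
  Cons (eS p.1) (eT p.2).

Lemma polytime_zip X (f : X -> tree) (S T : X -> Type)
    (eS : forall x, S x -> tree) (eT : forall x, T x -> tree)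
    (l1 : forall x, seq (S x)) (l2 : forall x, seq (T x)) :
  polytime f (fun x => enc_seq (@eS x) (l1 x)) ->
  polytime f (fun x => enc_seq (@eT x) (l2 x)) ->
  polytime f (fun x => enc_seq (enc_pair (@eS x) (@eT x)) (zip (l1 x) (l2 x))).
Proof.
move=> Hl1 Hl2; pose e x := enc_pair (@eS x) (@eT x).
pose step x (p : seq (T x) * seq (S x * T x)) (s : S x) :=
  if p.1 is t :: r then (r, (s, t) :: p.2) else p.
have stepE x r1 r2 o :
    (foldl (@step x) (r2, o) r1).2 = catrev (zip r1 r2) o.
  elim: r1 r2 o => [|s r1 IH] [|t r2] o //=; last exact: IH.
  by rewrite IH; case: (r1).
suff H : polytime f (fun x => enc_pair (enc_seq (@eT x)) (enc_seq (e x))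
    (foldl (@step x) (l2 x, [::]) (l1 x))).
  apply: polytime_ext (polytime_rev (polytime_tl H)) => x.
  by rewrite stepE revK.
apply: (polytime_foldl_incr
  (eS := fun x => enc_pair (enc_seq (@eT x)) (enc_seq (e x)))
  (s0 := fun x => (l2 x, [::])) (D := fun z => tree_size (eS _ (tagged z)) + 1)
  Hl1 (polytime_cons Hl2 (polytime_nil f))).
- move=> Y h g p s _ Hp Hs.
  have [Hr Ho] := (polytime_hd Hp, polytime_tl Hp).
  have Hpush := polytime_cons (polytime_tl Hr)
    (polytime_cons (polytime_cons Hs (polytime_hd Hr)) Ho).
  apply: polytime_ext (polytime_ifnil Hr Hpush Hp) => y.
  by rewrite /step /enc_pair /=; case: (p y) => [[|t r] o].
- by apply: poly_boundedW (poly_bounded_id _) => z /=; lia.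
- by move=> x [[|t r] o] s; rewrite /step /e /enc_pair /=; lia.
Qed.

Lemma polytime_map_zip X (f : X -> tree) (T : X -> Type)
    (e1 e2 : forall x, T x -> tree) (l : forall x, seq (T x)) :
  polytime f (fun x => enc_seq (@e1 x) (l x)) ->
  polytime f (fun x => enc_seq (@e2 x) (l x)) ->
  polytime f (fun x => enc_seq (fun t => Cons (@e1 x t) (@e2 x t)) (l x)).
Proof.
move=> Hl1 Hl2; apply: polytime_ext (polytime_zip Hl1 Hl2) => x.
by elim: (l x) => //= t r ->.
Qed.

Lemma polytime_nseq_size X (f : X -> tree) (S T : X -> Type)
    (eS : forall x, S x -> tree) (eT : forall x, T x -> tree)
    (l : forall x, seq (S x)) (t : forall x, T x) :
  polytime f (fun x => enc_seq (@eS x) (l x)) ->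
  polytime f (fun x => eT _ (t x)) ->
  polytime f (fun x => enc_seq (@eT x) (nseq (size (l x)) (t x))).
Proof.
move=> Hl Ht.
apply: polytime_ext (polytime_map (e' := fun x _ => eT x (t x)) Hl _) => [x|].
  by elim: (l x) => //= s r ->.
by move=> Y h g s Hf _; apply: polytime_lift Hf Ht.
Qed.

(** * Binary arithmetic *)

Definition nat_of_bits (s : seq bool) : nat :=
  foldr (fun (b : bool) n => b + n.*2) 0 s.

(* [nat_bits] has no leading zeros, so 0 is not prepended to the code of 0. *)
Definition cons_bit (b : bool) (s : seq bool) : seq bool :=
  if b then b :: s else if s is [::] then [::] else b :: s.

Lemma nat_bits_cons (b : bool) n :
  nat_bits (b + n.*2) = cons_bit b (nat_bits n).
Proof.
rewrite -[n]bin_of_natK {2}/nat_bits nat_of_binK /cons_bit.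
case: (bin_of_nat n) => [|p] /=; first by case: b.
have -> : b + (nat_of_pos p).*2 = nat_of_bin (Npos (if b then xI p else xO p)).
  by case: b; rewrite /= NatTrec.trecE.
by rewrite /nat_bits nat_of_binK; case: b => //=; case: p.
Qed.

Lemma nat_bits_of_bits s : nat_bits (nat_of_bits s) = foldr cons_bit [::] s.
Proof. by elim: s => //= b s IH; rewrite nat_bits_cons IH. Qed.

Lemma nat_bitsK : cancel nat_bits nat_of_bits.
Proof.
move=> n; rewrite -[RHS]bin_of_natK /nat_bits; case: (bin_of_nat n) => // p.
by elim: p => //= p ->; rewrite NatTrec.trecE.
Qed.

Lemma ltn_nat_of_bits s : nat_of_bits s < 2 ^ size s.
Proof. by elim: s => //= b s IH; rewrite expnS; case: b; lia. Qed.

Lemma nat_of_bits_pad s n : nat_of_bits (s ++ nseq n false) = nat_of_bits s.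
Proof. by elim: s => [|b s IH] /=; [elim: n => //= n -> | rewrite IH]. Qed.

Lemma tree_size_enc_bits s : tree_size (enc_seq enc_bool s) <= 4 * size s + 1.
Proof. exact: tree_size_enc_seq_le tree_size_enc_bool. Qed.

Lemma size_nat_bits n k : n < 2 ^ k -> size (nat_bits n) <= k.
Proof.
elim: k n => [|k IH] n; first by case: n.
rewrite expnS -{2}(odd_double_half n) nat_bits_cons => lt_n.
have /IH : n./2 < 2 ^ k by have := odd_double_half n; lia.
by rewrite /cons_bit; case: (odd n); case: (nat_bits _) => //= *; lia.
Qed.

Lemma tree_size_enc_nat n k : n < 2 ^ k -> tree_size (enc_nat n) <= 4 * k + 1.
Proof.
move=> /size_nat_bits le_k.
by apply: leq_trans (tree_size_enc_bits _) _; lia.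
Qed.

Lemma ltn_exp_tree_size n : n < 2 ^ tree_size (enc_nat n).
Proof.
rewrite -{1}[n]nat_bitsK; apply: leq_trans (ltn_nat_of_bits _) _.
by rewrite leq_exp2l // size_le_enc_seq.
Qed.

Lemma polytime_nat_of_bits X (f : X -> tree) (s : X -> seq bool) :
  polytime f (fun x => enc_seq enc_bool (s x)) ->
  polytime f (fun x => enc_nat (nat_of_bits (s x))).
Proof.
move=> Hs; apply: polytime_ext (polytime_foldr_incr
  (eS := fun=> enc_seq enc_bool) (s0 := fun=> [::]) (step := fun=> cons_bit)
  (D := fun=> 4) Hs (polytime_nil f) _ _ _) => [x|Y h g b o _ Hb Ho||x b o].
- by rewrite /enc_nat nat_bits_of_bits.
- apply: polytime_ext (polytime_ifnil Hb (polytime_cons Hb Ho)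
    (polytime_ifnil Ho (polytime_cons Hb Ho) (polytime_nil g))) => y.
  by rewrite /cons_bit; case: (b y); case: (o y).
- exact: poly_bounded_const.
- by case: b; case: o => //= *; lia.
Qed.

Definition pad_zip (a b : seq bool) : seq (bool * bool) :=
  zip (a ++ nseq (size b) false) (b ++ nseq (size a) false).

Lemma nat_of_unzip_pad_zip m n (z := pad_zip (nat_bits m) (nat_bits n)) :
  nat_of_bits (unzip1 z) = m /\ nat_of_bits (unzip2 z) = n.
Proof.
have eq_size : size (nat_bits m ++ nseq (size (nat_bits n)) false) =
    size (nat_bits n ++ nseq (size (nat_bits m)) false).
  by rewrite !size_cat !size_nseq addnC.
by rewrite unzip1_zip ?unzip2_zip ?eq_size // !nat_of_bits_pad !nat_bitsK.
Qed.

Lemma polytime_pad_zip X (f : X -> tree) (a b : X -> nat) :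
  polytime f (fun x => enc_nat (a x)) -> polytime f (fun x => enc_nat (b x)) ->
  polytime f (fun x => enc_seq (enc_pair enc_bool enc_bool)
    (pad_zip (nat_bits (a x)) (nat_bits (b x)))).
Proof.
have Hpad u v : polytime f (fun x => enc_nat (u x)) ->
    polytime f (fun x => enc_nat (v x)) -> polytime f (fun x =>
      enc_seq enc_bool (nat_bits (u x) ++ nseq (size (nat_bits (v x))) false)).
  move=> Hu Hv; exact: (polytime_cat Hu (polytime_nseq_size
    (eT := fun=> enc_bool) (t := fun=> false) Hv (polytime_nil f))).
by move=> Ha Hb; apply: (polytime_zip (Hpad _ _ Ha Hb) (Hpad _ _ Hb Ha)).
Qed.

Definition majority (a b c : bool) : bool := if a then b || c else b && c.

Fixpoint ripple_carry (c : bool) (z : seq (bool * bool)) : seq bool :=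
  if z is (a, b) :: z' then a (+) (b (+) c) :: ripple_carry (majority a b c) z'
  else [:: c].

Lemma nat_of_ripple_carry c z :
  nat_of_bits (ripple_carry c z) =
  c + nat_of_bits (unzip1 z) + nat_of_bits (unzip2 z).
Proof.
elim: z c => [|[a b] z IH] c /=; first by case: c.
by rewrite IH; case: a; case: b; case: c => /=; lia.
Qed.

(* The state is the carry followed by the digits computed so far, most
   significant first. *)
Definition carry_step (st : bool * seq bool) (p : bool * bool) :
    bool * seq bool :=
  (majority p.1 p.2 st.1, p.1 (+) (p.2 (+) st.1) :: st.2).

Lemma foldl_carry_step z c o :
  let st := foldl carry_step (c, o) z in
  rev (st.1 :: st.2) = catrev o (ripple_carry c z).
Proof. by elim: z c o => [|[a b] z IH] c o //=; rewrite IH. Qed.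

Lemma polytime_add X (f : X -> tree) (a b : X -> nat) :
  polytime f (fun x => enc_nat (a x)) -> polytime f (fun x => enc_nat (b x)) ->
  polytime f (fun x => enc_nat (a x + b x)).
Proof.
move=> Ha Hb; pose z x := pad_zip (nat_bits (a x)) (nat_bits (b x)).
pose digits (st : bool * seq bool) := st.1 :: st.2.
suff Hst : polytime f (fun x =>
    enc_seq enc_bool (digits (foldl carry_step (false, [::]) (z x)))).
  apply: polytime_ext (polytime_nat_of_bits (polytime_rev Hst)) => x.
  rewrite foldl_carry_step nat_of_ripple_carry.
  by have [-> ->] := nat_of_unzip_pad_zip (a x) (b x).
apply: (polytime_foldl_incr (eS := fun=> enc_seq enc_bool \o digits)
  (s0 := fun=> (false, [::])) (step := fun=> carry_step) (D := fun=> 7)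
  (polytime_pad_zip Ha Hb) (polytime_const f _)).
- move=> Y h g st p _ Hst Hp.
  have [Hc Ho] := (polytime_hd Hst, polytime_tl Hst).
  have [Hu Hv] := (polytime_hd Hp, polytime_tl Hp).
  apply: polytime_cons.
    exact: (polytime_if (e := fun=> enc_bool) Hu (polytime_bool2 orb Hv Hc)
      (polytime_bool2 andb Hv Hc)).
  apply: polytime_cons Ho.
  exact: (polytime_bool2 addb Hu (polytime_bool2 addb Hv Hc)).
- exact: poly_bounded_const.
- by move=> x [c o] [u v]; case: u; case: v; case: c => /=; lia.
Qed.

Definition leq_step (r : bool) (p : bool * bool) : bool :=
  if p.1 (+) p.2 then p.2 else r.

Lemma foldl_leq_step z (r : bool) :
  foldl leq_step r z =
  (nat_of_bits (unzip1 z) + ~~ r <= nat_of_bits (unzip2 z)).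
Proof.
elim: z r => [|[a b] z IH] r /=; first by case: r.
by rewrite IH /leq_step; case: a; case: b; case: r => /=; lia.
Qed.

Lemma polytime_leq X (f : X -> tree) (a b : X -> nat) :
  polytime f (fun x => enc_nat (a x)) -> polytime f (fun x => enc_nat (b x)) ->
  polytime f (fun x => enc_bool (a x <= b x)).
Proof.
move=> Ha Hb; apply: polytime_ext (polytime_foldl_incr (eS := fun=> enc_bool)
  (s0 := fun=> true) (step := fun=> leq_step) (D := fun=> 3)
  (polytime_pad_zip Ha Hb) (polytime_const f _) _ _ _)
  => [x|Y h g r p _ Hr Hp||x r p].
- rewrite foldl_leq_step addn0.
  by have [-> ->] := nat_of_unzip_pad_zip (a x) (b x).
- have [Hu Hv] := (polytime_hd Hp, polytime_tl Hp).
  exact: (polytime_if (e := fun=> enc_bool) (polytime_bool2 addb Hu Hv) Hv Hr).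
- exact: poly_bounded_const.
- exact: leq_trans (tree_size_enc_bool _) (leq_addl _ _).
Qed.

Lemma polytime_mul X (f : X -> tree) (a b : X -> nat) :
  polytime f (fun x => enc_nat (a x)) -> polytime f (fun x => enc_nat (b x)) ->
  polytime f (fun x => enc_nat (a x * b x)).
Proof.
move=> Ha Hb.
pose step x (c : bool) n := (if c then b x else 0) + (n + n).
have hornerE x s : foldr (step x) 0 s = nat_of_bits s * b x.
  by elim: s => //= c s ->; rewrite /step; case: c; lia.
pose k x := tree_size (enc_nat (a x)) + tree_size (enc_nat (b x)).
apply: polytime_ext (polytime_foldr (eS := fun=> enc_nat) (s0 := fun=> 0)
  (step := step) (b := fun x => 4 * k x + 1) Ha (polytime_nil f) _ _ _)
  => [x|Y h g c n Hf Hc Hn||x pre suf Eax].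
- by rewrite hornerE nat_bitsK.
- apply: polytime_add (polytime_add Hn Hn).
  exact: (polytime_if (e := fun=> enc_nat) (t := fun=> 0) Hc
    (polytime_lift Hf Hb) (polytime_nil g)).
- apply: poly_boundedD (poly_bounded_const _ _).
  apply: poly_boundedM (poly_bounded_const _ _) _.
  exact: poly_boundedD (polytime_size Ha) (polytime_size Hb).
- apply: tree_size_enc_nat; rewrite hornerE expnD ltn_mul ?ltn_exp_tree_size //.
  apply: leq_trans (ltn_nat_of_bits suf) _; rewrite leq_exp2l //.
  apply: leq_trans (size_le_enc_seq enc_bool suf) _.
  by rewrite /enc_nat Eax leq_enc_seq_suffix.
Qed.

(** * Fractions *)

Definition frac : Type := nat * nat.
Definition enc_frac : frac -> tree := enc_pair enc_nat enc_nat.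

Definition represents (p : frac) (q : rat) : Prop :=
  0 < p.2 /\ q = (p.1%:R / p.2%:R)%R.

Definition frac_of_rat (q : rat) : frac := (`|numq q|%N, `|denq q|%N).
Definition frac_add (p q : frac) : frac := (p.1 * q.2 + q.1 * p.2, p.2 * q.2).
Definition frac_le (p q : frac) : bool := p.1 * q.2 <= q.1 * p.2.
Definition frac_sum (l : seq frac) : frac := foldr frac_add (0, 1) l.

Lemma represents_frac_of_rat q : (0 <= q)%R -> represents (frac_of_rat q) q.
Proof.
move=> q_ge0; split; first by rewrite absz_gt0 denq_neq0.
rewrite -[LHS]divq_num_den /= !pmulrn !abszE.
by rewrite ger0_norm ?numq_ge0 // gtr0_norm ?denq_gt0.
Qed.

Lemma represents0 : represents (0, 1) 0%R.
Proof. by split; rewrite //= mul0r. Qed.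

Lemma represents_add p p' q q' : represents p q -> represents p' q' ->
  represents (frac_add p p') (q + q')%R.
Proof.
move=> [p_gt0 ->] [p'_gt0 ->]; split; first by rewrite muln_gt0 p_gt0.
by rewrite natrD !natrM addf_div // pnatr_eq0 -lt0n.
Qed.

Lemma represents_natmul n p q : represents p q ->
  represents (n * p.1, p.2) (n%:R * q)%R.
Proof. by move=> [p_gt0 ->]; split=> //=; rewrite natrM mulrA. Qed.

Lemma represents_le p p' q q' : represents p q -> represents p' q' ->
  frac_le p p' = (q <= q')%R.
Proof.
move=> [p_gt0 ->] [p'_gt0 ->]; rewrite ler_pdivrMr ?ltr0n // mulrAC.
by rewrite ler_pdivlMr ?ltr0n // -!natrM ler_nat.
Qed.

Lemma represents_sum (I : Type) (r : seq I) (p : I -> frac) (q : I -> rat) :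
  (forall i, represents (p i) (q i)) ->
  represents (frac_sum [seq p i | i <- r]) (\sum_(i <- r) q i)%R.
Proof.
move=> pq; elim: r => [|i r IH] /=.
  by rewrite big_nil; apply: represents0.
by rewrite big_cons; apply: represents_add.
Qed.

(* Fractions are not reduced; the sum of numerator and denominator is
   submultiplicative under [frac_add], which keeps their bit length linear. *)
Lemma ltn_frac_sum l :
  (frac_sum l).1 + (frac_sum l).2 < 2 ^ tree_size (enc_seq enc_frac l).
Proof.
have ltn_frac p : p.1 + p.2 < 2 ^ tree_size (enc_frac p).
  case: p => n d; rewrite /enc_frac /enc_pair /= expnS expnD.
  have := ltn_exp_tree_size n; have := ltn_exp_tree_size d.
  by move: (2 ^ _) (2 ^ _) => *; nia.
elim: l => // p l IH; move: (ltn_frac p) IH.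
rewrite /= -/(frac_sum l) /frac_add.
case: p (frac_sum l) => [n d] [n' d'] /= lt_p lt_l.
apply: leq_ltn_trans (_ : _ <= (n + d) * (n' + d')) _; first by nia.
by rewrite -addnS expnD ltn_mul // (ltn_trans lt_l) // ltn_exp2l.
Qed.

Lemma polytime_frac_add X (f : X -> tree) (p q : X -> frac) :
  polytime f (fun x => enc_frac (p x)) ->
  polytime f (fun x => enc_frac (q x)) ->
  polytime f (fun x => enc_frac (frac_add (p x) (q x))).
Proof.
move=> Hp Hq; have [Hpnum Hpden] := (polytime_hd Hp, polytime_tl Hp).
have [Hqnum Hqden] := (polytime_hd Hq, polytime_tl Hq).
by apply: polytime_cons; [apply: polytime_add|]; apply: polytime_mul.
Qed.

Lemma polytime_frac_le X (f : X -> tree) (p q : X -> frac) :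
  polytime f (fun x => enc_frac (p x)) ->
  polytime f (fun x => enc_frac (q x)) ->
  polytime f (fun x => enc_bool (frac_le (p x) (q x))).
Proof.
move=> Hp Hq; have [Hpnum Hpden] := (polytime_hd Hp, polytime_tl Hp).
have [Hqnum Hqden] := (polytime_hd Hq, polytime_tl Hq).
by apply: polytime_leq; apply: polytime_mul.
Qed.

Lemma polytime_frac_sum X (f : X -> tree) (l : X -> seq frac) :
  polytime f (fun x => enc_seq enc_frac (l x)) ->
  polytime f (fun x => enc_frac (frac_sum (l x))).
Proof.
move=> Hl; pose k x := tree_size (enc_seq enc_frac (l x)).
apply: (polytime_foldr (eS := fun=> enc_frac) (s0 := fun=> (0, 1))
  (step := fun=> frac_add) (b := fun x => 8 * k x + 3) Hl (polytime_const f _))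
  => [Y h g p q _||x pre suf Elx].
- exact: polytime_frac_add.
- apply: poly_boundedD (poly_bounded_const _ _).
  exact: poly_boundedM (poly_bounded_const _ _) (polytime_size Hl).
have le_k : 2 ^ tree_size (enc_seq enc_frac suf) <= 2 ^ k x.
  by rewrite leq_exp2l // /k Elx leq_enc_seq_suffix.
have := leq_trans (ltn_frac_sum suf) le_k; rewrite -/(frac_sum suf).
case: (frac_sum suf) => n d /= lt_nd.
have := tree_size_enc_nat (leq_ltn_trans (leq_addr d n) lt_nd).
by have := tree_size_enc_nat (leq_ltn_trans (leq_addl n d) lt_nd); lia.
Qed.

(** * Sets of vertices *)

Definition border_identity (rows : seq (seq bool)) : seq (seq bool) :=
  (true :: [seq false | _ <- rows]) :: [seq false :: r | r <- rows].

Lemma iter_border_identity (T : eqType) (l : seq T) : uniq l ->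
  iter (size l) border_identity [::] = [seq [seq x == y | y <- l] | x <- l].
Proof.
elim: l => //= x l IH /andP [xl /IH ->].
rewrite /border_identity eqxx -!map_comp.
congr ((_ :: _) :: _); apply/eq_in_map => y yl /=.
  by apply/esym/negbTE; apply: contraNneq xl => ->.
by congr (_ :: _); apply/esym/negbTE; apply: contraNneq xl => <-.
Qed.

Lemma tree_size_border_identity i :
  tree_size (enc_seq (enc_seq enc_bool) (iter i border_identity [::])) <=
  (4 * i + 2) * i + 1.
Proof.
have := @iter_border_identity _ (iota 0 i).
rewrite iota_uniq size_iota => -> //; rewrite enc_seq_map.
apply: leq_trans (tree_size_enc_seq_le (n := 4 * i + 1) _ _) _ => [x|].
  by apply: leq_trans (tree_size_enc_bits _) _; rewrite size_map size_iota.
by rewrite size_iota -addnS.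
Qed.

Lemma polytime_border_identity X (f : X -> tree) :
  polytime1 f (fun=> enc_seq (enc_seq enc_bool))
    (fun=> enc_seq (enc_seq enc_bool)) (fun=> border_identity).
Proof.
move=> Y h g r _ Hr.
have Hfalses : polytime g (fun y => enc_seq enc_bool [seq false | _ <- r y]).
  apply: polytime_ext (polytime_map (e' := fun=> fun=> Nil) Hr _) => [y|].
    by rewrite enc_seq_map.
  by move=> *; apply: polytime_nil.
have Hrows : polytime g
    (fun y => enc_seq (enc_seq enc_bool) [seq false :: s | s <- r y]).
  apply: polytime_ext (polytime_map
    (e' := fun=> enc_seq enc_bool \o cons false) Hr _) => [y|].
    by rewrite enc_seq_map.
  by move=> Z h' g' s _ Hs; apply: polytime_cons (polytime_nil _) Hs.
apply: polytime_cons Hrows; apply: polytime_cons Hfalses.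
exact: polytime_const.
Qed.

Section VertexSets.
Variables (X : Type) (f : X -> tree) (V : X -> finType).
Implicit Types S T : forall x, {set V x}.

Section Vertices.
Variable e : forall x, V x -> tree.
Hypothesis He : polytime f (fun x => enc_seq (@e x) (enum (V x))).

Lemma polytime_set0 : polytime f (fun x => enc_set (set0 : {set V x})).
Proof.
apply: (polytime_map He) => Y h g v _ _.
by apply: polytime_ext (polytime_nil _) => y; rewrite inE.
Qed.

Lemma polytime_setT : polytime f (fun x => enc_set (setT : {set V x})).
Proof.
apply: (polytime_map He) => Y h g v _ _.
by apply: polytime_ext (polytime_const _ (enc_bool true)) => y; rewrite inE.
Qed.

Lemma poly_bounded_card : poly_bounded (tree_size \o f) (fun x => #|V x|).
Proof.
by apply: poly_boundedW (polytime_size He) => x; rewrite cardE size_le_enc_seq.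
Qed.

Lemma polytime_set1 : polytime f
  (fun x => enc_seq (fun v : V x => enc_set [set v]) (enum (V x))).
Proof.
have size_i x i : i <= size (enum (V x)) ->
    tree_size (enc_seq (enc_seq enc_bool) (iter i border_identity [::])) <=
    (4 * #|V x| + 2) * #|V x| + 1.
  rewrite -cardE => le_i; apply: leq_trans (tree_size_border_identity i) _.
  by rewrite leq_add2r leq_mul // leq_add2r leq_mul.
apply: polytime_ext (polytime_iter (eS := fun=> enc_seq (enc_seq enc_bool))
  (s0 := fun=> [::]) He (polytime_nil f) (@polytime_border_identity X f) _
  size_i) => [x|].
  rewrite iter_border_identity ?enum_uniq // enc_seq_map.
  apply: eq_enc_seq => v /=; rewrite enc_seq_map.
  by apply: eq_enc_seq => u /=; rewrite inE eq_sym.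
have bconst n := poly_bounded_const (tree_size \o f) n.
have bV := poly_bounded_card.
by do ?[apply: poly_boundedD | apply: poly_boundedM].
Qed.

End Vertices.

Lemma polytime_setU S T :
  polytime f (fun x => enc_set (S x)) -> polytime f (fun x => enc_set (T x)) ->
  polytime f (fun x => enc_set (S x :|: T x)).
Proof.
move=> HS HT; apply: (polytime_map (polytime_map_zip HS HT)) => Y h g v _ Hv.
apply: polytime_ext (polytime_bool2 orb (polytime_hd Hv) (polytime_tl Hv)) => y.
by rewrite inE.
Qed.

Lemma polytime_subset S T :
  polytime f (fun x => enc_set (S x)) -> polytime f (fun x => enc_set (T x)) ->
  polytime f (fun x => enc_bool (S x \subset T x)).
Proof.
move=> HS HT; apply: polytime_ext (polytime_all
  (P := fun x v => (v \in S x) ==> (v \in T x))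
  (polytime_map_zip HS HT) _) => [x|].
  congr enc_bool; apply/allP/subsetP => [sST v vS | sST v _].
    by have := sST v (mem_enum _ _); rewrite vS.
  exact/implyP/sST.
move=> Y h g v _ Hv.
exact: (polytime_bool2 implb (polytime_hd Hv) (polytime_tl Hv)).
Qed.

End VertexSets.

Lemma tree_size_enc_set (V : finType) (S : {set V}) :
  tree_size (enc_set S) <= 4 * #|V| + 1.
Proof.
by rewrite cardE; apply: tree_size_enc_seq_le => v; apply: tree_size_enc_bool.
Qed.

(** * The approximation scheme *)

Lemma dag_sink (V : finType) (A : rel V) (D : {set V}) : dag A -> D != set0 ->
  exists2 v, v \in D & forall y, A v y -> y \notin D.
Proof.
move=> dagA /set0Pn [v0 v0D].
have [v vD vmin] := arg_minnP (fun v => #|connect A v|) v0D.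
exists v => // y Avy; apply/negP => yD.
have sub : connect A y \subset connect A v.
  by apply/subsetP => z; apply: connect_trans (connect1 Avy).
have vy : connect A y v.
  suff /subsetP : connect A v \subset connect A y by apply; apply: connect0.
  by rewrite -(geq_leqif (subset_leqif_card sub)) vmin.
have [p Ap /esym last_p] := connectP vy.
case: (shortenP Ap) last_p => q Aq uniq_q _ last_q.
by apply: (dagA (y :: q)) => //; rewrite /ucycle /= rcons_path Aq last_q Avy.
Qed.

Lemma iter_inflationary_fixed (T : finType) (F : {set T} -> {set T})
    (S : {set T}) :
  (forall U : {set T}, U \subset F U) -> F (iter #|T| F S) = iter #|T| F S.
Proof.
move=> infl; have grow n : F (iter n F S) = iter n F S \/ n <= #|iter n F S|.
  elim: n => [|n [fixn|le_n]]; [by right | by left; rewrite /= !fixn |].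
  have := infl (iter n F S); rewrite subEproper => /orP [/eqP fixn|].
    by left; rewrite /= -!fixn.
  by move=> /proper_card; right; apply: leq_ltn_trans le_n _.
have [//|full] := grow #|T|.
have /eqP -> : iter #|T| F S == setT by rewrite eqEcard subsetT cardsT.
by apply/eqP; rewrite eqEsubset subsetT infl.
Qed.

Section BoundedSearch.
Variables (V : finType) (w : V -> rat) (F : {set V} -> {set V}).
Implicit Types S T H best : {set V}.

Definition lighter S T : {set V} :=
  if (weight w S <= weight w T)%R then S else T.

(* The lightest among [best] and the values of [F] at the sets that extend [H]
   by at most [j] vertices. *)
Fixpoint search j H best : {set V} :=
  if j is j'.+1 then
    foldl (fun b v => search j' (v |: H) b) (search j' H best) (enum V)
  else lighter best (F H).

Lemma weight_lighter_l S T : (weight w (lighter S T) <= weight w S)%R.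
Proof. by rewrite /lighter; case: (leP (weight w S)) => // /ltW. Qed.

Lemma weight_lighter_r S T : (weight w (lighter S T) <= weight w T)%R.
Proof. by rewrite /lighter; case: (leP (weight w S)). Qed.

Lemma search_ind (Q : {set V} -> Prop) j H best :
  (forall S, Q (F S)) -> Q best -> Q (search j H best).
Proof.
move=> QF; elim: j H best => [|j IH] H best Qbest /=.
  by rewrite /lighter; case: ifP.
elim: (enum V) (search j H best) (IH H best Qbest) => //= v l IHl b Qb.
by apply: IHl; apply: IH.
Qed.

Lemma weight_foldl_search_le j H best l :
  (forall H' b, (weight w (search j H' b) <= weight w b)%R) ->
  (weight w (foldl (fun b v => search j (v |: H) b) best l) <=
   weight w best)%R.
Proof.
by move=> le; elim: l best => //= v l IH best; apply: le_trans (IH _) (le _ _).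
Qed.

Lemma weight_search_le j H best :
  (weight w (search j H best) <= weight w best)%R.
Proof.
elim: j H best => [|j IH] H best /=; first exact: weight_lighter_l.
exact: le_trans (weight_foldl_search_le _ _ _ IH) (IH _ _).
Qed.

Lemma weight_search_le_extension j H H' best : #|H'| <= j ->
  (weight w (search j H best) <= weight w (F (H' :|: H)))%R.
Proof.
have fold_le i := weight_foldl_search_le _ _ _ (weight_search_le i).
elim: j H H' best => [|j IH] H H' best.
  by rewrite leqn0 cards_eq0 => /eqP ->; rewrite set0U; apply: weight_lighter_r.
move=> le_j /=; have [->|[v vH']] := set_0Vmem H'.
  by apply: le_trans (fold_le _ _ _ _) _; apply: IH; rewrite cards0.
have vV : v \in enum V by rewrite mem_enum.
case/splitPr: vV => l1 l2; rewrite foldl_cat /=.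
apply: le_trans (fold_le _ _ _ _) _.
have -> : H' :|: H = (H' :\ v) :|: (v |: H).
  by rewrite setUA [_ :\ v :|: _]setUC setD1K.
by apply: IH; move: le_j; rewrite (cardsD1 v) vH'.
Qed.

End BoundedSearch.

Section Algorithm.
Variables (V : finType) (A : rel V) (w : V -> rat) (B : rat).
Implicit Types (P S T H : {set V}).

Definition out_nbrs (v : V) : {set V} := [set y | A v y].

Definition light_set (k : nat) : {set V} := [set v | k.+1%:R * w v <= B]%R.

Definition try_add P S (v : V) : {set V} :=
  if [&& v \in P, out_nbrs v \subset S & (weight w (v |: S) <= B)%R]
  then v |: S else S.

Definition pass P S : {set V} := foldl (try_add P) S (enum V).

Definition greedy P S : {set V} := iter #|V| (pass P) S.

Definition candidate k H : {set V} :=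
  greedy setT (greedy (light_set k :|: H) set0).

Definition ptas k : {set V} :=
  search w (candidate k) k set0 (candidate k set0).

Definition saturated P S : Prop := forall v, v \in P -> out_nbrs v \subset S ->
  (weight w (v |: S) <= B)%R -> v \in S.

Lemma digraph_constraintsP S :
  digraph_constraints A S <-> forall v, v \in S -> out_nbrs v \subset S.
Proof.
split=> [cS v vS|cS x y xS Axy].
  by apply/subsetP => y; rewrite inE; apply: cS.
by have /subsetP := cS x xS; apply; rewrite inE.
Qed.

Lemma ssg_setU1 S v : ssg_set A w B S -> out_nbrs v \subset S ->
  (weight w (v |: S) <= B)%R -> ssg_set A w B (v |: S).
Proof.
move=> [/digraph_constraintsP cS _] ov le_B; split=> //.
apply/digraph_constraintsP => x /setU1P [->|/cS ox];
  exact: subset_trans (subsetUr _ _).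
Qed.

Lemma feasible_saturated P S : feasible A w B S -> saturated P S.
Proof.
move=> [sS maxS] v _ ov le_B; apply: contraT => vS.
case: (maxS (v |: S)); last exact: ssg_setU1.
rewrite properEneq subsetUr andbT.
by apply: contraNneq vS => ->; rewrite setU11.
Qed.

Lemma greedy_ind (Q : {set V} -> Prop) P S : Q S ->
  (forall T v, Q T -> v \in P -> out_nbrs v \subset T ->
    (weight w (v |: T) <= B)%R -> Q (v |: T)) ->
  Q (greedy P S).
Proof.
move=> QS Qadd; rewrite /greedy; elim: #|V| => //= n.
move: (iter _ _ _) => T; rewrite /pass; elim: (enum V) T => //= v l IH T QT.
by apply: IH; rewrite /try_add; case: ifP => // /and3P [*]; apply: Qadd.
Qed.

Lemma greedy_ssg P S : ssg_set A w B S -> ssg_set A w B (greedy P S).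
Proof. by move=> sS; apply: greedy_ind => // T v sT _; apply: ssg_setU1. Qed.

Lemma greedy_id P S : saturated P S -> greedy P S = S.
Proof.
move=> satS; apply: (greedy_ind (Q := eq^~ S)) => // T v -> vP ov le_B.
by apply/setUidPr; rewrite sub1set satS.
Qed.

Lemma sub_try_add P S v : S \subset try_add P S v.
Proof. by rewrite /try_add; case: ifP => // _; apply: subsetUr. Qed.

Lemma sub_foldl_try_add P S l : S \subset foldl (try_add P) S l.
Proof.
elim: l S => //= v l IH S; exact: subset_trans (sub_try_add P S v) (IH _).
Qed.

Lemma pass_fixed_saturated P S : pass P S = S -> saturated P S.
Proof.
rewrite /pass => fixS v vP ov le_B; have vV : v \in enum V by rewrite mem_enum.
case/splitPr: vV fixS => l1 l2; rewrite foldl_cat /= => fixS.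
set S1 := foldl (try_add P) S l1 in fixS.
have sub2 : try_add P S1 v \subset S.
  by have := sub_foldl_try_add P (try_add P S1 v) l2; rewrite fixS.
have S1E : S1 = S.
  apply/eqP; rewrite eqEsubset sub_foldl_try_add andbT.
  exact: subset_trans (sub_try_add P S1 v) sub2.
by apply: (subsetP sub2); rewrite S1E /try_add vP ov le_B setU11.
Qed.

Lemma greedy_saturated P S : saturated P (greedy P S).
Proof.
apply: pass_fixed_saturated; apply: iter_inflationary_fixed => T.
exact: sub_foldl_try_add.
Qed.

Hypotheses (dagA : dag A) (w_ge0 : forall v, (0 <= w v)%R) (B_ge0 : (0 <= B)%R).

Lemma weight_subset S T : S \subset T -> (weight w S <= weight w T)%R.
Proof.
move=> sST; rewrite /weight [leRHS](big_setID S) /= (setIidPr sST) lerDl.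
exact: sumr_ge0.
Qed.

Lemma ssg_set0 : ssg_set A w B set0.
Proof. by split; [move=> x y; rewrite inE | rewrite /weight big_set0]. Qed.

(* A sink of [T :\: S] does the job. *)
Lemma addable_vertex S T : digraph_constraints A T -> S \proper T ->
  exists v, [/\ v \in T, v \notin S & out_nbrs v \subset S].
Proof.
move=> cT /properP [_ [x xT xS]].
have /(dag_sink dagA) [v] : T :\: S != set0.
  by apply/set0Pn; exists x; rewrite inE xS.
rewrite inE => /andP [vS vT] sink; exists v; split=> //.
apply/subsetP => y; rewrite inE => Avy; have := sink y Avy.
by rewrite inE (cT v y vT Avy) andbT negbK.
Qed.

Lemma proper_not_saturated P S T :
  ssg_set A w B T -> S \proper T -> T \subset P -> ~ saturated P S.
Proof.
move=> [cT wT] prST /subsetP sTP satS.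
have [v [vT vS ov]] := addable_vertex cT prST.
case/negP: vS; apply: satS => //; first exact: sTP.
by apply: le_trans wT; rewrite weight_subset // subUset sub1set vT proper_sub.
Qed.

Lemma saturated_feasible S : ssg_set A w B S -> saturated setT S ->
  feasible A w B S.
Proof.
move=> sS satS; split=> // T prST sT.
exact: proper_not_saturated sT prST (subsetT T) satS.
Qed.

Lemma candidate_feasible k H : feasible A w B (candidate k H).
Proof.
apply: saturated_feasible; last exact: greedy_saturated.
by do 2!apply: greedy_ssg; apply: ssg_set0.
Qed.

(* If [w(S) < kB/(k+1)], no light vertex can be added to [S], so greedy addition
   of light vertices and heavy vertices of [S] never leaves [S]; it cannot stop
   strictly inside [S] either. *)
Lemma candidate_exact k S : feasible A w B S ->
  (k.+1%:R * weight w S < k%:R * B)%R ->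
  candidate k (S :\: light_set k) = S.
Proof.
move=> fS lt_kB; have [sS _] := fS; rewrite /candidate.
set P := _ :|: _; set S1 := greedy P set0.
have sSP : S \subset P.
  by apply/subsetP => v vS; rewrite !inE vS andbT orbN.
have sub : S1 \subset S.
  apply: (greedy_ind (Q := fun T => T \subset S)); first exact: sub0set.
  move=> T v sTS vP ov _; rewrite subUset sub1set sTS andbT.
  apply: contraT => vS; case/negP: (vS).
  have light_v : (k.+1%:R * w v <= B)%R.
    by move: vP; rewrite !inE (negbTE vS) andbF orbF.
  apply: (feasible_saturated fS (in_setT v)); first exact: subset_trans ov sTS.
  rewrite /weight big_setU1 //= -(ler_pM2l (ltr0Sn _ k)) mulrDr -/(weight w S).
  by move: lt_kB light_v; rewrite -natr1; lra.
suff -> : S1 = S by apply/greedy_id/feasible_saturated.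
apply/eqP; rewrite eqEproper sub; apply/negP => prS1.
exact: proper_not_saturated sS prS1 sSP (@greedy_saturated P set0).
Qed.

Lemma card_heavy k S : (weight w S <= B)%R -> #|S :\: light_set k| <= k.
Proof.
move=> wS; rewrite leqNgt; apply/negP => lt_k; set H := S :\: _ in lt_k.
have wH : (weight w H <= B)%R.
  by apply: le_trans wS; rewrite weight_subset ?subsetDl.
suff : (k.+1%:R * B < k.+1%:R * weight w H)%R.
  by apply/negP; rewrite -leNgt ler_pM2l ?ltr0Sn.
apply: le_lt_trans (_ : _ <= #|H|%:R * B)%R _.
  by rewrite ler_wpM2r ?ler_nat.
rewrite /weight mulr_sumr mulr_natl -sumr_const; apply: ltr_sum => [|v].
  have /card_gt0P [v vH] : 0 < #|H| by apply: leq_trans lt_k.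
  by apply/hasP; exists v => //; apply: mem_index_enum.
by rewrite !inE -ltNge => /andP [].
Qed.

Lemma ptas_feasible k : feasible A w B (ptas k).
Proof. by apply: search_ind => *; apply: candidate_feasible. Qed.

Lemma ptas_ratio k opt : 0 < k -> optimal_value A w B opt ->
  (weight w (ptas k) <= k.+1%:R / k%:R * opt)%R.
Proof.
move=> k_gt0 [[S fS <-] _]; have k_gt0R : (0 < k%:R :> rat)%R by rewrite ltr0n.
rewrite mulrAC ler_pdivlMr // mulrC.
have [le_kB|lt_kB] := lerP (k%:R * B) (k.+1%:R * weight w S).
  by apply: le_trans le_kB; rewrite ler_pM2l //; have [[_]] := ptas_feasible k.
have := weight_search_le_extension w (candidate k) set0 (candidate k set0)
  (card_heavy k fS.1.2).
rewrite setU0 candidate_exact // -/(ptas k) => le_S.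
apply: le_trans (_ : _ <= k%:R * weight w S)%R _; first by rewrite ler_pM2l.
by rewrite ler_wpM2r ?ler_nat // sumr_ge0.
Qed.

Lemma exists_optimal : exists opt, optimal_value A w B opt.
Proof.
pose ssgb S := [forall v in S, out_nbrs v \subset S] && (weight w S <= B)%R.
have ssgP S : reflect (ssg_set A w B S) (ssgb S).
  apply: (iffP andP) => -[cS wS]; split=> //.
    by apply/digraph_constraintsP => v; apply: (forall_inP cS).
  by apply/forall_inP => v; apply: (iffLR (digraph_constraintsP S) cS).
have feasP S : reflect (feasible A w B S) (maxset ssgb S).
  apply: (iffP maxsetP) => -[/ssgP sS maxS]; split=> // T.
    move=> prST /ssgP sT; have TS := maxS T sT (proper_sub prST).
    by rewrite TS properxx in prST.
  move=> /ssgP sT; rewrite subEproper => /orP [/eqP //|/maxS].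
  by case/(_ sT).
have [S /feasP fS minS] :=
  arg_minP (weight w) (introT (feasP _) (candidate_feasible 0 set0)).
exists (weight w S); split; first by exists S.
by move=> T /feasP /minS.
Qed.

End Algorithm.

(** * Running time of the scheme *)

Record instance := Instance {
  vertex : finType;
  arc : rel vertex;
  cost : vertex -> rat;
  budget : rat;
  cost_ge0 : forall v, (0 <= cost v)%R;
  budget_ge0 : (0 <= budget)%R }.

Definition enc_inst (I : instance) : tree :=
  enc_instance (@arc I) (@cost I) (budget I).

Definition enc_vertex (I : instance) (v : vertex I) : tree :=
  Cons (enc_set [set v]) (enc_set (out_nbrs (@arc I) v)).

Definition frac_weight (I : instance) (S : {set vertex I}) : frac :=
  frac_sum [seq if v \in S then frac_of_rat (cost v) else (0, 1)
           | v <- enum (vertex I)].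

Lemma represents_weight (I : instance) (S : {set vertex I}) :
  represents (frac_weight S) (weight (@cost I) S).
Proof.
rewrite /weight big_mkcond -big_enum; apply: represents_sum => v.
case: ifP => _; [exact/represents_frac_of_rat/cost_ge0 | exact: represents0].
Qed.

Section PolytimeScheme.
Variables (X : Type) (f : X -> tree) (I : X -> instance).
Hypothesis HI : polytime f (fun x => enc_inst (I x)).
Implicit Types S T : forall x, {set vertex (I x)}.

Lemma polytime_budget :
  polytime f (fun x => enc_frac (frac_of_rat (budget (I x)))).
Proof. exact: (polytime_hd HI). Qed.

Lemma polytime_costs : polytime f (fun x =>
  enc_seq (fun v => enc_frac (frac_of_rat (cost v))) (enum (vertex (I x)))).
Proof. exact: (polytime_hd (polytime_tl HI)). Qed.

Lemma polytime_vertices :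
  polytime f (fun x => enc_seq (@enc_vertex (I x)) (enum (vertex (I x)))).
Proof.
apply: polytime_map_zip; first exact: polytime_set1 polytime_costs.
apply: polytime_ext (polytime_tl (polytime_tl HI)) => x /=.
by apply: eq_enc_seq => v; apply: eq_enc_seq => y; rewrite inE.
Qed.

Lemma poly_bounded_enc_set :
  poly_bounded (tree_size \o f) (fun x => 4 * #|vertex (I x)| + 1).
Proof.
apply: poly_boundedD (poly_bounded_const _ _).
apply: poly_boundedM (poly_bounded_const _ _) _.
exact: poly_bounded_card polytime_costs.
Qed.

Lemma polytime_frac_weight S :
  polytime f (fun x => enc_set (S x)) ->
  polytime f (fun x => enc_frac (frac_weight (S x))).
Proof.
move=> HS; apply: polytime_frac_sum.
apply: polytime_ext (polytime_map (e' := fun x v => enc_frac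
  (if v \in S x then frac_of_rat (cost v) else (0, 1)))
  (polytime_map_zip polytime_costs HS) _) => [x|Y h g v _ Hv].
  by rewrite enc_seq_map.
exact: (polytime_if (e := fun=> enc_frac) (t := fun=> (0, 1)) (polytime_tl Hv)
  (polytime_hd Hv) (polytime_const g _)).
Qed.

Lemma polytime_weight_le_budget S :
  polytime f (fun x => enc_set (S x)) ->
  polytime f (fun x =>
    enc_bool (weight (@cost (I x)) (S x) <= budget (I x))%R).
Proof.
move=> /polytime_frac_weight HS.
apply: polytime_ext (polytime_frac_le HS polytime_budget) => x.
by rewrite (represents_le (represents_weight _)
  (represents_frac_of_rat (budget_ge0 _))).
Qed.

Lemma polytime_lighter S T :
  polytime f (fun x => enc_set (S x)) -> polytime f (fun x => enc_set (T x)) ->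
  polytime f (fun x => enc_set (lighter (@cost (I x)) (S x) (T x))).
Proof.
move=> HS HT; have Hle :=
  polytime_frac_le (polytime_frac_weight HS) (polytime_frac_weight HT).
apply: polytime_ext (polytime_if (e := fun x => @enc_set (vertex (I x)))
  Hle HS HT) => x.
by rewrite (represents_le (represents_weight _) (represents_weight _)).
Qed.

Lemma polytime_light_set k :
  polytime f (fun x => enc_set (light_set (@cost (I x)) (budget (I x)) k)).
Proof.
apply: (polytime_map polytime_costs) => Y h g v Hf Hv.
have Hmul : polytime g (fun y => enc_frac
    (k.+1 * (frac_of_rat (cost (v y))).1, (frac_of_rat (cost (v y))).2)).
  apply: polytime_cons (polytime_tl Hv).
  exact: polytime_mul (polytime_const g (enc_nat k.+1)) (polytime_hd Hv).
apply: polytime_ext (polytime_frac_le Hmul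
  (polytime_lift Hf polytime_budget)) => y.
by rewrite inE (represents_le (represents_natmul _ (represents_frac_of_rat _))
  (represents_frac_of_rat _)) ?cost_ge0 ?budget_ge0.
Qed.

End PolytimeScheme.

Lemma polytime_try_add X (f : X -> tree) (I : X -> instance)
    (P S : forall x, {set vertex (I x)}) (v : forall x, vertex (I x)) :
  polytime f (fun x => enc_inst (I x)) ->
  polytime f (fun x => enc_set (P x)) -> polytime f (fun x => enc_set (S x)) ->
  polytime f (fun x => enc_vertex (v x)) ->
  polytime f (fun x => enc_set
    (try_add (@arc (I x)) (@cost (I x)) (budget (I x)) (P x) (S x) (v x))).
Proof.
move=> HI HP HS Hv; have [Hset1 Hout] := (polytime_hd Hv, polytime_tl Hv).
have HU := polytime_setU Hset1 HS.
have Htest := polytime_bool2 andb (polytime_subset Hset1 HP) (polytime_bool2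
  andb (polytime_subset Hout HS) (polytime_weight_le_budget HI HU)).
apply: polytime_ext (polytime_if (e := fun x => @enc_set (vertex (I x)))
  Htest HU HS) => x.
by rewrite /try_add sub1set.
Qed.

Lemma polytime_pass X (f : X -> tree) (I : X -> instance)
    (P S : forall x, {set vertex (I x)}) :
  polytime f (fun x => enc_inst (I x)) ->
  polytime f (fun x => enc_set (P x)) -> polytime f (fun x => enc_set (S x)) ->
  polytime f (fun x => enc_set
    (pass (@arc (I x)) (@cost (I x)) (budget (I x)) (P x) (S x))).
Proof.
move=> HI HP HS; apply: (polytime_foldl (eS := fun x => @enc_set (vertex (I x)))
  (polytime_vertices HI) HS _ (poly_bounded_enc_set HI)) => [|*].
  move=> Y h g T v Hf HT Hv.
  exact: polytime_try_add (polytime_lift Hf HI) (polytime_lift Hf HP) HT Hv.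
exact: tree_size_enc_set.
Qed.

Lemma polytime_greedy X (f : X -> tree) (I : X -> instance)
    (P S : forall x, {set vertex (I x)}) :
  polytime f (fun x => enc_inst (I x)) ->
  polytime f (fun x => enc_set (P x)) -> polytime f (fun x => enc_set (S x)) ->
  polytime f (fun x => enc_set
    (greedy (@arc (I x)) (@cost (I x)) (budget (I x)) (P x) (S x))).
Proof.
move=> HI HP HS; apply: polytime_ext (polytime_iter
  (eS := fun x => @enc_set (vertex (I x))) (F := fun x =>
    pass (@arc (I x)) (@cost (I x)) (budget (I x)) (P x))
  (polytime_vertices HI) HS _ (poly_bounded_enc_set HI) _)
  => [x|Y h g T Hf HT|*].
- by rewrite /greedy cardE.
- exact: polytime_pass (polytime_lift Hf HI) (polytime_lift Hf HP) HT.
- exact: tree_size_enc_set.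
Qed.

Lemma polytime_candidate k X (f : X -> tree) (I : X -> instance)
    (H : forall x, {set vertex (I x)}) :
  polytime f (fun x => enc_inst (I x)) -> polytime f (fun x => enc_set (H x)) ->
  polytime f (fun x => enc_set
    (candidate (@arc (I x)) (@cost (I x)) (budget (I x)) k (H x))).
Proof.
move=> HI HH; have Hcosts := polytime_costs HI.
apply: (polytime_greedy HI (polytime_setT Hcosts)).
apply: (polytime_greedy HI _ (polytime_set0 Hcosts)).
exact: (polytime_setU (polytime_light_set HI k) HH).
Qed.

Lemma polytime_search j X (f : X -> tree) (I : X -> instance)
    (F : forall x, {set vertex (I x)} -> {set vertex (I x)})
    (H best : forall x, {set vertex (I x)}) :
  polytime f (fun x => enc_inst (I x)) ->
  polytime1 f (fun x => @enc_set (vertex (I x)))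
    (fun x => @enc_set (vertex (I x))) F ->
  polytime f (fun x => enc_set (H x)) ->
  polytime f (fun x => enc_set (best x)) ->
  polytime f (fun x => enc_set (search (@cost (I x)) (@F x) j (H x) (best x))).
Proof.
elim: j X f I F H best => [|j IH] X f I F H best HI HF HH Hbest.
  exact: (polytime_lighter HI Hbest (HF X id f H (polytime_id f) HH)).
apply: (polytime_foldl (eS := fun x => @enc_set (vertex (I x)))
  (step := fun x b v => search (@cost (I x)) (@F x) j (v |: H x) b)
  (polytime_vertices HI) (IH _ _ _ _ _ _ HI HF HH Hbest) _
  (poly_bounded_enc_set HI)) => [|*]; last exact: tree_size_enc_set.
move=> Y h g b v Hf Hb Hv; apply: (IH _ _ _ (fun y => @F (h y))) => //.
- exact: polytime_lift Hf HI.
- move=> Z h' g' S Hg HS; apply: HF => //; exact: polytime_lift Hg Hf.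
- exact: (polytime_setU (polytime_hd Hv) (polytime_lift Hf HH)).
Qed.

Lemma polytime_ptas k :
  polytime enc_inst (fun I => enc_set (ptas (@arc I) (@cost I) (budget I) k)).
Proof.
have HI := polytime_id enc_inst.
have H0 := polytime_set0 (polytime_costs HI).
apply: (polytime_search k HI _ H0 (polytime_candidate k HI H0)).
by move=> Y h g S Hf HS; apply: polytime_candidate.
Qed.

Theorem theorem5 (k : nat) (hk : (1 <= k)%N) :
  exists (p : cmd) (c d : nat),
  forall (V : finType) (A : rel V) (w : V -> rat) (B : rat),
    dag A -> (forall v : V, (0 <= w v)%R) -> (0 < B)%R ->
    exists (t : nat) (S : {set V}) (opt : rat),
      [/\ runs p (enc_instance A w B) t (enc_set S),
          (t <= c * tree_size (enc_instance A w B) ^ d + c)%N,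
          feasible A w B S,
          optimal_value A w B opt
        & (weight w S <= (k.+1)%:R / k%:R * opt)%R].
Proof.
have [p [c [d run]]] := polytime_runs (polytime_ptas k).
exists p, c, d => V A w B dagA w_ge0 /ltW B_ge0.
have [t [run_t le_t]] := run (Instance A w_ge0 B_ge0).
have [opt Hopt] := exists_optimal dagA w_ge0 B_ge0.
exists t, (ptas A w B k), opt; split=> //.
- exact: ptas_feasible.
- exact: ptas_ratio.
Qed.
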